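(* Let $n\ge 2$, $0<\alpha<1$ and $\beta=1-\alpha$. For $x,y\in\mathbb{R}^n\setminus\{0\}$ let $\theta\in[0,\pi]$ be the angle between $x$ and $y$ at the origin. Then $$k_\alpha(x,y)=\frac1\beta\sqrt{|x|^{2\beta}+|y|^{2\beta}-2|x|^\beta|y|^\beta\cos\beta\theta}.$$ In particular, as $\alpha\to 1$, $k_\alpha(x,y)\to\sqrt{\theta^2+\log^2(|x|/|y|)}$.
   Context: The $\alpha$--quasihyperbolic metric of $\mathbb{R}^n\setminus\{0\}$ is $k_\alpha(x,y)=\inf_\gamma\int_\gamma \frac{|dz|}{|z|^{\alpha}}$, the infimum taken over all rectifiable paths $\gamma$ in $\mathbb{R}^n\setminus\{0\}$ joining $x$ and $y$. *)

(* Defs.v *)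
From HB Require Import structures.
From mathcomp Require Import all_boot all_order all_algebra.
From mathcomp Require Import all_classical all_reals all_analysis.
Set Implicit Arguments. Unset Strict Implicit. Unset Printing Implicit Defensive.
Import Order.TTheory GRing.Theory Num.Theory.
Import numFieldNormedType.Exports.
Local Open Scope classical_set_scope.
Local Open Scope ring_scope.

Section Defs.
Variables (R : realType) (n : nat).
Implicit Types (x y : 'rV[R]_n).

Definition edot x y : R := \sum_(i < n) x ord0 i * y ord0 i.
Definition enorm x : R := Num.sqrt (edot x x).

Definition angle x y : R := acos (edot x y / (enorm x * enorm y)).

Definition is_partition (a b : R) (p : nat -> R) (N : nat) : Prop :=
  p 0%N = a /\ p N = b /\ forall i, (i < N)%N -> p i <= p i.+1.

Definition chord_sum (g : R -> 'rV[R]_n) (p : nat -> R) (N : nat) : R :=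
  \sum_(i < N) enorm (g (p i.+1) - g (p i)).

Definition is_path (g : R -> 'rV[R]_n) : Prop :=
  {within `[0, 1], continuous g}.

Definition rectifiable (g : R -> 'rV[R]_n) : Prop :=
  exists M : R, forall p N, is_partition 0 1 p N -> chord_sum g p N <= M.

Definition arclen (g : R -> 'rV[R]_n) (t : R) : R :=
  sup [set l | exists p N, is_partition 0 t p N /\ l = chord_sum g p N].

(* I is the integral \int_g f |dz|, i.e. the Riemann-Stieltjes integral
   of f (g t) with respect to the arc-length function of g over [0,1]. *)
Definition line_integral_is (f : 'rV[R]_n -> R) (g : R -> 'rV[R]_n) (I : R)
  : Prop :=
  forall eps : R, 0 < eps -> exists2 delta : R, 0 < delta &
    forall (p : nat -> R) (N : nat) (xi : nat -> R),
      is_partition 0 1 p N ->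
      (forall i, (i < N)%N -> p i.+1 - p i < delta) ->
      (forall i, (i < N)%N -> p i <= xi i <= p i.+1) ->
      `| \sum_(i < N) f (g (xi i)) * (arclen g (p i.+1) - arclen g (p i)) - I|
        < eps.

Definition k_alpha (alpha : R) x y : R :=
  inf [set I | exists g : R -> 'rV[R]_n,
         is_path g /\ rectifiable g /\ g 0 = x /\ g 1 = y /\
         (forall t, 0 <= t <= 1 -> g t != 0) /\
         line_integral_is (fun z => (enorm z `^ alpha)^-1) g I].

End Defs.

(* Main.v *)
(* The map [r e^(i phi) |-> r^beta e^(i beta phi) / beta] turns the density
   [|z|^-alpha |dz|] into the Euclidean arc length, so the claimed value
   [kdist x y] is a distance in a Euclidean cone. Infinitesimally, [kdist u v]
   and [|u - v| / |u|^alpha] agree up to factors close to 1.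
   For the lower bound, the linear function on the cone in the direction
   from the image of [x] to that of [y], as a function of [|z|] and of the angle
   between [x] and [z], is 1-Lipschitz for [kdist] by the spherical triangle
   inequality, and its increments along a path are bounded by Riemann-Stieltjes
   sums. For the upper bound, the segment between the two images avoids the apex
   as [beta * theta < pi]; along its preimage in a plane through [x] and [y],
   [kdist] is proportional to the parameter, so that the integral of
   [|z|^-alpha |dz|] over it is [kdist x y]. *)
Require Import Defs.
From HB Require Import structures.
From mathcomp Require Import all_boot all_order all_algebra ring lra.
From mathcomp Require Import all_classical all_reals all_analysis.
Set Implicit Arguments.
Unset Strict Implicit.
Unset Printing Implicit Defensive.
Import Order.TTheory GRing.Theory Num.Theory.
Import numFieldNormedType.Exports.
Local Open Scope classical_set_scope.
Local Open Scope ring_scope.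

(** * Euclidean inner product and norm on row vectors *)

Section Euclid.
Context {R : realType} {n : nat}.
Implicit Types (x y z u v : 'rV[R]_n).

Lemma edotC x y : edot x y = edot y x.
Proof. by apply: eq_bigr => i _; rewrite mulrC. Qed.

Lemma edotDl x y z : edot (x + y) z = edot x z + edot y z.
Proof. by rewrite -big_split; apply: eq_bigr => i _; rewrite mxE mulrDl. Qed.

Lemma edotZl (a : R) x y : edot (a *: x) y = a * edot x y.
Proof.
by rewrite /edot mulr_sumr; apply: eq_bigr => i _; rewrite mxE mulrA.
Qed.

Lemma edotDr x y z : edot z (x + y) = edot z x + edot z y.
Proof. by rewrite edotC edotDl !(edotC z). Qed.

Lemma edotZr (a : R) x y : edot x (a *: y) = a * edot x y.
Proof. by rewrite edotC edotZl edotC. Qed.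

Lemma edotNl x y : edot (- x) y = - edot x y.
Proof. by rewrite -scaleN1r edotZl mulN1r. Qed.

Lemma edotNr x y : edot x (- y) = - edot x y.
Proof. by rewrite edotC edotNl edotC. Qed.

Definition edotE := (edotDl, edotDr, edotZl, edotZr, edotNl, edotNr).

Lemma edot_ge0 x : 0 <= edot x x.
Proof. by apply: sumr_ge0 => i _; rewrite -expr2 sqr_ge0. Qed.

Lemma edot_eq0 x : (edot x x == 0) = (x == 0).
Proof.
apply/idP/eqP => [|->]; last first.
  by rewrite /edot big1// => i _; rewrite mxE mul0r.
rewrite psumr_eq0 => [/allP x0|i _]; last by rewrite -expr2 sqr_ge0.
apply/rowP => i; rewrite mxE.
by have := x0 i (mem_index_enum i); rewrite /= -expr2 sqrf_eq0 => /eqP.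
Qed.

Lemma edot_gt0 x : x != 0 -> 0 < edot x x.
Proof. by move=> x0; rewrite lt0r edot_eq0 x0 edot_ge0. Qed.

Lemma enorm_ge0 x : 0 <= enorm x. Proof. exact: sqrtr_ge0. Qed.

Lemma enorm_gt0 x : x != 0 -> 0 < enorm x.
Proof. by move=> x0; rewrite sqrtr_gt0 edot_gt0. Qed.

Lemma sqr_enorm x : enorm x ^+ 2 = edot x x.
Proof. by rewrite sqr_sqrtr// edot_ge0. Qed.

Lemma enorm_sqrP x (a : R) : 0 <= a -> edot x x = a ^+ 2 -> enorm x = a.
Proof. by move=> a0 xa; rewrite /enorm xa sqrtr_sqr ger0_norm. Qed.

Lemma enorm0 : enorm (0 : 'rV[R]_n) = 0.
Proof. by apply: enorm_sqrP => //; apply/eqP; rewrite expr0n edot_eq0. Qed.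

Lemma enormZ (a : R) x : enorm (a *: x) = `|a| * enorm x.
Proof.
apply: enorm_sqrP; first by rewrite mulr_ge0// enorm_ge0.
by rewrite exprMn sqr_enorm real_normK ?num_real// !edotE mulrA expr2.
Qed.

(** The squared norm of [edot y y *: x - edot x y *: y] is [edot y y] times the difference of the
    two sides. *)
Lemma edot_CauchySchwarz x y : edot x y ^+ 2 <= edot x x * edot y y.
Proof.
have [->|y0] := eqVneq y 0.
  have e0 z : edot z 0 = 0 by rewrite -(scale0r (0 : 'rV[R]_n)) edotZr mul0r.
  by rewrite !e0 expr0n mulr0.
have := edot_ge0 (edot y y *: x - edot x y *: y).
rewrite !edotE (edotC y x) => H.
rewrite -subr_ge0 -(pmulr_rge0 _ (edot_gt0 y0)).
by apply: le_trans H _; rewrite le_eqVlt; apply/orP; left; apply/eqP; ring.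
Qed.

Lemma ler_edot_enorm x y : `|edot x y| <= enorm x * enorm y.
Proof.
rewrite -(@ler_pXn2r _ 2)// ?nnegrE ?mulr_ge0 ?enorm_ge0//.
by rewrite real_normK ?num_real// exprMn !sqr_enorm edot_CauchySchwarz.
Qed.

Lemma ler_enormD x y : enorm (x + y) <= enorm x + enorm y.
Proof.
rewrite -(@ler_pXn2r _ 2)// ?nnegrE ?addr_ge0 ?enorm_ge0//.
rewrite sqrrD !sqr_enorm !edotE (edotC y x).
by have := ler_edot_enorm x y; rewrite ler_norml => /andP[_]; lra.
Qed.

Lemma enormB x y : enorm (x - y) = enorm (y - x).
Proof. by rewrite -opprB -scaleN1r enormZ normrN normr1 mul1r. Qed.

Lemma ler_dist_enorm x y : `|enorm x - enorm y| <= enorm (x - y).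
Proof.
rewrite ler_norml; have := ler_enormD (x - y) y; have := ler_enormD (y - x) x.
by rewrite !subrK (enormB y x) => *; apply/andP; split; lra.
Qed.

Lemma ler_coord_enorm x i : `|x ord0 i| <= enorm x.
Proof.
rewrite -sqrtr_sqr ler_sqrt ?edot_ge0// /edot (bigD1 i)//= expr2.
by rewrite lerDl; apply: sumr_ge0 => j _; rewrite -expr2 sqr_ge0.
Qed.

(** Continuity is stated in the maximum norm; this bound and [ler_coord_enorm] carry it to the
    Euclidean norm and back. The crude factor [n] suffices for that. *)
Lemma enorm_le_mx_norm x : enorm x <= n%:R * `|x|.
Proof.
rewrite -(@ler_pXn2r _ 2)// ?nnegrE ?mulr_ge0 ?enorm_ge0//.
rewrite sqr_enorm exprMn.
apply: (@le_trans _ _ (\sum_(i < n) `|x| ^+ 2)).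
  apply: ler_sum => i _; rewrite -expr2 -real_normK ?num_real//.
  rewrite ler_pXn2r// ?nnegrE//.
  rewrite [`|x|]mx_normrE.
  exact: (le_bigmax _ (fun ij => `|x ij.1 ij.2|) (ord0, i)).
rewrite sumr_const card_ord -[leLHS]mulr_natl ler_wpM2r ?sqr_ge0//.
by rewrite -natrX ler_nat; case: n => // k; rewrite leq_pmulr.
Qed.

End Euclid.

(** * Sines and cosines of [t] and [b * t] compared *)

Section Trigonometry.
Context {R : realType}.
Implicit Types (b t u : R).

Lemma ler_cos : {in `[0, pi] &, {mono (@cos R) : t u /~ t <= u}}.
Proof. by move=> t u tP uP; rewrite leNgt ltr_cos// -leNgt. Qed.

(** The difference of the two sides vanishes at 0, and its derivative [b * (cos (b * u) - cos u)] is
    nonnegative because cosine decreases on [[0, pi]]. *)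
Lemma sin_le_mul b t : 0 <= b <= 1 -> 0 <= t <= pi ->
  b * sin t <= sin (b * t).
Proof.
move=> /andP[b0 b1] /andP[t0 tpi].
pose f u := sin (b * u) - b * sin u.
have df u : is_derive u 1 f (b * (cos (b * u) - cos u)).
  by apply: is_derive_eq; rewrite /GRing.scale/=; ring.
have [|c /itvP cI] := MVT_segment t0 (fun u _ => df u).
  apply: continuous_subspaceT => u.
  by apply/differentiable_continuous/derivable1_diffP; case: (df u).
rewrite {2}/f !(mulr0, sin0, subr0) -subr_ge0 -/(f t) => ->.
rewrite mulr_ge0// mulr_ge0// subr_ge0 ler_cos ?in_itv/= ?cI ?mulr_ge0 ?cI//=.
- by rewrite ler_piMl ?cI.
- by rewrite (le_trans _ tpi) ?cI.
- by rewrite (le_trans _ tpi)// (le_trans (ler_piMl _ b1)) ?cI.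
Qed.

Lemma sin_le t : 0 <= t -> sin t <= t.
Proof.
move=> t0; have [|c _] := MVT_segment t0 (fun u _ => is_derive_sin u).
  exact/continuous_subspaceT/continuous_sin.
by rewrite sin0 !subr0 => ->; rewrite ler_piMl ?cos_le1.
Qed.

Lemma mul_cos_le_sin t : 0 <= t <= pi -> t * cos t <= sin t.
Proof.
move=> /andP[t0 tpi].
have [|c /itvP cI] := MVT_segment t0 (fun u _ => is_derive_sin u).
  exact/continuous_subspaceT/continuous_sin.
rewrite sin0 !subr0 mulrC => ->.
rewrite ler_wpM2l// ler_cos ?in_itv/= ?cI ?t0//=.
by rewrite (le_trans _ tpi) ?cI.
Qed.

Lemma oneBcos t : 1 - cos t = 2 * sin (t / 2) ^+ 2.
Proof.
rewrite [in cos t](_ : t = (t / 2) *+ 2); last by rewrite mulr2n; lra.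
by rewrite cos_mulr2n cos2sin2 mulr2n; ring.
Qed.

(** Half-angle formulas turn both sides into squared sines, which [sin_le_mul] compares at
    [t / 2]. *)
Lemma oneBcos_mul_ge b t : 0 <= b <= 1 -> 0 <= t <= pi ->
  b ^+ 2 * (1 - cos t) <= 1 - cos (b * t).
Proof.
move=> /andP[b0 b1] /andP[t0 tpi]; rewrite !oneBcos mulrCA ler_pM2l// -exprMn.
have s0 : 0 <= sin (t / 2) by apply: sin_ge0_pi; apply/andP; split; lra.
have := @sin_le_mul b (t / 2); rewrite b0 b1 => /(_ isT) H.
rewrite -mulrA ler_pXn2r ?nnegrE ?mulr_ge0//.
- by apply: H; apply/andP; split; lra.
- apply: le_trans (H _); first by rewrite mulr_ge0.
  by apply/andP; split; lra.
Qed.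

(** Converse of [oneBcos_mul_ge] up to the factor [cos (t / 2) ^+ 2], close to 1 for small [t]. It
    squares the chain cos(t/2) sin(bt/2) <= cos(t/2) bt/2 <= b sin(t/2). *)
Lemma oneBcos_mul_le b t : 0 <= b <= 1 -> 0 <= t <= pi ->
  (1 + cos t) / 2 * (1 - cos (b * t)) <= b ^+ 2 * (1 - cos t).
Proof.
move=> /andP[b0 b1] /andP[t0 tpi].
have -> : (1 + cos t) / 2 = cos (t / 2) ^+ 2.
  by have := oneBcos t; rewrite sin2cos2 => H; lra.
rewrite !oneBcos mulrCA [leRHS]mulrCA ler_pM2l// -!exprMn -mulrA.
have c0 : 0 <= cos (t / 2) by apply: cos_ge0_pihalf; apply/andP; split; lra.
have bt : 0 <= b * (t / 2) <= pi.
  rewrite mulr_ge0 ?divr_ge0//=; apply: le_trans (_ : t / 2 <= _); last by lra.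
  by rewrite ler_piMl// divr_ge0.
have s0 : 0 <= sin (b * (t / 2)) by exact: sin_ge0_pi.
have := @mul_cos_le_sin (t / 2); have := @sin_le (b * (t / 2)).
case/andP: (bt) => -> _ /(_ isT) H1 H2.
have {}H2 := H2 ltac:(apply/andP; split; lra).
have s1 : 0 <= sin (t / 2).
  by apply: le_trans H2; rewrite mulr_ge0// divr_ge0.
rewrite ler_pXn2r ?nnegrE ?mulr_ge0//.
apply: le_trans (ler_wpM2l c0 H1) _.
by rewrite mulrCA ler_wpM2l// mulrC.
Qed.

End Trigonometry.

(** * Angles at the origin and the spherical triangle inequality *)

Section Angle.
Context {R : realType} {n : nat}.
Implicit Types (x y z u v : 'rV[R]_n).

Lemma cos_ratio_itv x y : -1 <= edot x y / (enorm x * enorm y) <= 1.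
Proof.
rewrite -ler_norml normrM normfV [`|_ * _|]ger0_norm ?mulr_ge0 ?enorm_ge0//.
(* If a vector is zero, the quotient is 0 because the inverse of 0 is 0. *)
have [->|e0] := eqVneq (enorm x * enorm y) 0; first by rewrite invr0 mulr0.
by rewrite ler_pdivrMr ?mul1r ?ler_edot_enorm// lt0r e0 mulr_ge0 ?enorm_ge0.
Qed.

Lemma angle_itv x y : 0 <= angle x y <= pi.
Proof. by rewrite acos_ge0 ?acos_lepi ?cos_ratio_itv. Qed.

Lemma edot_angle x y : x != 0 -> y != 0 ->
  edot x y = enorm x * enorm y * cos (angle x y).
Proof.
move=> x0 y0; rewrite acosK ?in_itv/= ?cos_ratio_itv//.
by rewrite mulrC divfK// mulf_neq0// gt_eqF ?enorm_gt0.
Qed.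

Lemma angleP x y (t : R) : x != 0 -> y != 0 -> 0 <= t <= pi ->
  edot x y = enorm x * enorm y * cos t -> angle x y = t.
Proof.
move=> x0 y0 tP; rewrite edot_angle// => /mulfI cE.
apply: cos_inj; rewrite ?in_itv/= ?angle_itv//.
by apply: cE; rewrite mulf_neq0// gt_eqF ?enorm_gt0.
Qed.

Lemma angle_id x : x != 0 -> angle x x = 0.
Proof.
move=> x0; apply: angleP => //; first by rewrite lexx pi_ge0.
by rewrite cos0 mulr1 -expr2 sqr_enorm.
Qed.

(** Law of cosines, split into a radial and an angular term to match [cone_dist]. *)
Lemma sqr_enormB x y : x != 0 -> y != 0 ->
  enorm (x - y) ^+ 2 =
  (enorm x - enorm y) ^+ 2 + 2 * (enorm x * enorm y) * (1 - cos (angle x y)).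
Proof.
move=> x0 y0; rewrite sqr_enorm !edotE (edotC y x) (edot_angle x0 y0).
by rewrite -!sqr_enorm; ring.
Qed.

(* Cauchy-Schwarz for the components of [u] and [v] orthogonal to [x]. *)
Lemma cos_angle_triangle x u v : x != 0 -> u != 0 -> v != 0 ->
  cos (angle u v) <= cos (angle x u - angle x v).
Proof.
move=> x0 u0 v0; rewrite cosB.
have [X0 U0 V0] : [/\ 0 < enorm x, 0 < enorm u & 0 < enorm v].
  by rewrite !enorm_gt0.
pose w z := edot x x *: z - edot x z *: x.
have nw z : z != 0 ->
    enorm (w z) = enorm x ^+ 2 * enorm z * sin (angle x z).
  move=> z0; apply: enorm_sqrP.
    by rewrite !mulr_ge0 ?enorm_ge0// sin_ge0_pi ?angle_itv.
  rewrite exprMn sin2cos2 /w !edotE (edotC z x) (edot_angle x0 z0).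
  by rewrite -!sqr_enorm; ring.
have := ler_edot_enorm (w u) (w v); rewrite !nw// => /(le_trans (ler_norm _)).
rewrite /w !edotE (edotC u x) (edot_angle u0 v0) (edot_angle x0 u0).
rewrite (edot_angle x0 v0) -!sqr_enorm.
set X := enorm x in X0 *; set U := enorm u in U0 *; set V := enorm v in V0 *.
move=> H; rewrite -subr_ge0 -(@pmulr_rge0 _ (X ^+ 4 * (U * V))); last first.
  by rewrite mulr_gt0 ?exprn_gt0// mulr_gt0.
rewrite -subr_ge0 in H; apply: le_trans H _.
by rewrite le_eqVlt; apply/orP; left; apply/eqP; ring.
Qed.

(** By [cos_angle_triangle] and monotonicity of cosine, the difference of the angles at [x] is at
    most [angle u v] in absolute value; scaling by [b <= 1] keeps both in [[0, pi]]. *)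
Lemma cos_mul_angle_triangle (b : R) x u v :
  0 <= b <= 1 -> x != 0 -> u != 0 -> v != 0 ->
  cos (b * angle u v) <= cos (b * (angle x u - angle x v)).
Proof.
move=> /andP[b0 b1] x0 u0 v0; have := cos_angle_triangle x0 u0 v0.
have /andP[uv0 uvpi] := angle_itv u v.
have /andP[xu0 xupi] := angle_itv x u; have /andP[xv0 xvpi] := angle_itv x v.
have dpi : `|angle x u - angle x v| <= pi.
  by rewrite ler_norml; apply/andP; split; lra.
rewrite -(cos_norm (_ - _)) -(cos_norm (b * (_ - _))) normrM (ger0_norm b0).
rewrite !ler_cos ?in_itv/= ?normr_ge0 ?mulr_ge0 ?uv0//=; first exact: ler_wpM2l.
- exact: le_trans (ler_piMl _ b1) _.
- exact: le_trans (ler_piMl _ b1) _.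
Qed.

End Angle.

(** * The cone distance compared with the Euclidean chord *)

Section ConeDistance.
Context {R : realType}.
Implicit Types (al a c k m M th : R).

(* The distance, in the Euclidean cone scaled by [(1 - al)^-1], between the
   points with polar coordinates [(a `^ (1 - al), (1 - al) * phi)] and
   [(c `^ (1 - al), (1 - al) * (phi + th))]; the radicand is arranged as a sum
   of two nonnegative terms. *)
Definition cone_dist al a c th : R :=
  (1 - al)^-1 * Num.sqrt ((a `^ (1 - al) - c `^ (1 - al)) ^+ 2 +
    2 * (a `^ (1 - al) * c `^ (1 - al)) * (1 - cos ((1 - al) * th))).

Lemma powR_le_tangent (b t : R) : 0 < b < 1 -> 0 < t ->
  t `^ b <= 1 + b * (t - 1).
Proof.
move=> /andP[b0 b1] t0.
have b1' : 0 < 1 - b by lra.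
have := @conjugate_powR R (t `^ b) 1 b^-1 (1 - b)^-1 (powR_ge0 _ _) ler01.
rewrite !invr_gt0 b0 b1' !invrK => /(_ isT isT).
have -> : 1 `^ (1 - b)^-1 = 1 :> R by rewrite powR1.
rewrite -powRrM divff ?gt_eqF// powRr1 ?(ltW t0)// mulr1 => H.
by apply: le_trans (H _) _; lra.
Qed.

Lemma powR_1B al a : 0 < a -> a `^ (1 - al) = a / a `^ al.
Proof.
move=> a0; rewrite powRB ?powRr1 ?(ltW a0)//.
by apply/implyP => _; rewrite gt_eqF.
Qed.

(** A concave power lies below its tangent at [a]; the case of tangency at 1 is applied to [c / a]
    and rescaled. *)
Lemma powR_1B_sub_le al a c : 0 < al < 1 -> 0 < a -> 0 < c ->
  c `^ (1 - al) - a `^ (1 - al) <= (1 - al) / a `^ al * (c - a).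
Proof.
move=> /andP[al0 al1] a0 c0.
have c_a : 0 < c / a by rewrite divr_gt0.
have : 0 < 1 - al < 1 by apply/andP; split; lra.
move=> /powR_le_tangent/(_ c_a)/(ler_wpM2l (powR_ge0 a (1 - al))).
rewrite -powRM ?(ltW a0) ?(ltW c_a)// mulrCA divff ?gt_eqF// mulr1.
rewrite lerBlDl => /le_trans; apply.
set A := a `^ _.
have -> : A = a / a `^ al by rewrite /A powR_1B.
have A0 : a `^ al != 0 by rewrite gt_eqF ?powR_gt0.
by rewrite le_eqVlt; apply/orP; left; apply/eqP; field; rewrite A0 gt_eqF.
Qed.

Lemma sqr_chord_le al a c th M : 0 < al < 1 -> 0 < a <= M -> 0 < c <= M ->
  0 <= th <= pi ->
  (a - c) ^+ 2 + 2 * (a * c) * (1 - cos th) <=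
  (M `^ al * cone_dist al a c th) ^+ 2.
Proof.
move=> alP; have /andP[al0 al1] := alP.
wlog ca : a c / c <= a.
  have [ca|/ltW ac] := leP c a; first by move=> H; exact: H.
  move=> H aM cM thP; have := H c a ac cM aM thP.
  by rewrite /cone_dist -(sqrrN (c - a)) opprB -(sqrrN (c `^ _ - _)) opprB
    (mulrC c) (mulrC (c `^ _)).
move=> /andP[a0 aM] /andP[c0 cM] thP.
have b0 : 0 < 1 - al by lra.
have cosge0 (t : R) : 0 <= 1 - cos t by rewrite subr_ge0 cos_le1.
have M0 : 0 < M by exact: lt_le_trans aM.
have Mal : 0 < M `^ al by rewrite powR_gt0.
have [aal cal] : 0 < a `^ al /\ 0 < c `^ al by rewrite !powR_gt0.
have [aMal cMal] : a `^ al <= M `^ al /\ c `^ al <= M `^ al.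
  by split; apply: ge0_ler_powR => //; rewrite ?nnegrE ltW.
rewrite exprMn /cone_dist exprMn sqr_sqrtr; last first.
  by rewrite addr_ge0 ?sqr_ge0// !mulr_ge0 ?powR_ge0.
rewrite [in leRHS]mulrDr [in leRHS]mulrDr lerD//.
  (* Radial term, by the tangent at the larger modulus [a]. The angular term follows from
     [oneBcos_mul_ge]. *)
  have caE : c `^ (1 - al) <= a `^ (1 - al).
    by apply: ge0_ler_powR => //; rewrite ?nnegrE ltW.
  rewrite -!exprMn ler_pXn2r ?nnegrE ?subr_ge0//; last first.
    apply: mulr_ge0; first exact: powR_ge0.
    by apply: mulr_ge0; [rewrite invr_ge0 ltW|rewrite subr_ge0].
  have := powR_1B_sub_le alP a0 c0 => H.
  have {}H : (1 - al) / a `^ al * (a - c) <= a `^ (1 - al) - c `^ (1 - al).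
    by lra.
  rewrite mulrA; apply: le_trans (ler_wpM2l _ H); last first.
    by rewrite mulr_ge0 ?invr_ge0 ?ltW.
  rewrite mulrA ler_peMl ?subr_ge0//.
  rewrite mulrA mulfVK ?gt_eqF//.
  by rewrite ler_pdivlMr ?mul1r.
have H := @oneBcos_mul_ge R (1 - al) th.
have {}H := H ltac:(apply/andP; split; lra) thP.
have : 0 <= a * c by rewrite mulr_ge0 ?ltW.
rewrite !powR_1B// => ac0.
have acE : a / a `^ al * (c / c `^ al) = a * c / (a `^ al * c `^ al).
  by field; rewrite !gt_eqF.
rewrite acE.
apply: (@le_trans _ _ (M `^ al ^+ 2 * ((1 - al)^-1 ^+ 2 *
   (2 * (a * c / (a `^ al * c `^ al)) * ((1 - al) ^+ 2 *
      (1 - cos th)))))); last first.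
  rewrite ler_wpM2l ?sqr_ge0// ler_wpM2l ?sqr_ge0// ler_wpM2l//.
  by rewrite mulr_ge0// divr_ge0// mulr_ge0 ?ltW.
rewrite [leRHS](_ : _ = (M `^ al ^+ 2 / (a `^ al * c `^ al)) *
    (2 * (a * c) * (1 - cos th))); last by field; rewrite !gt_eqF.
rewrite ler_peMl ?mulr_ge0 ?(ltW a0) ?(ltW c0)//.
by rewrite ler_pdivlMr ?mulr_gt0// mul1r expr2 ler_pM ?(ltW aal) ?(ltW cal).
Qed.

(** Converse comparison on moduli at least [m]. The factor [k] absorbs the loss [(1 + cos th) / 2]
    of [oneBcos_mul_le]; the radial term uses the tangent at the smaller modulus. *)
Lemma cone_dist_le al a c th m k : 0 < al < 1 -> 0 < m -> m <= a -> m <= c ->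
  0 <= th <= pi -> 1 <= k -> 1 <= k ^+ 2 * ((1 + cos th) / 2) ->
  cone_dist al a c th <=
  k / m `^ al * Num.sqrt ((a - c) ^+ 2 + 2 * (a * c) * (1 - cos th)).
Proof.
move=> alP; have /andP[al0 al1] := alP.
wlog ca : a c / c <= a.
  have [ca|/ltW ac] := leP c a; first by move=> H; exact: H.
  move=> H m0 ma mc thP k1 kth; have := H c a ac m0 mc ma thP k1 kth.
  by rewrite /cone_dist -(sqrrN (c - a)) opprB -(sqrrN (c `^ _ - _)) opprB
    (mulrC c) (mulrC (c `^ _)).
move=> m0 ma mc thP k1 kth.
have b0 : 0 < 1 - al by lra.
have k0 : 0 < k by lra.
have cosge0 (t : R) : 0 <= 1 - cos t by rewrite subr_ge0 cos_le1.
have [a0 c0] : 0 < a /\ 0 < c by split; lra.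
have mal : 0 < m `^ al by rewrite powR_gt0.
have [aal cal] : 0 < a `^ al /\ 0 < c `^ al by rewrite !powR_gt0.
have [amal cmal] : m `^ al <= a `^ al /\ m `^ al <= c `^ al.
  by split; apply: ge0_ler_powR => //; rewrite ?nnegrE ltW.
rewrite /cone_dist mulrC ler_pdivrMr// -(@ler_pXn2r _ 2)//; last 2 first.
- by rewrite nnegrE sqrtr_ge0.
- by rewrite nnegrE !mulr_ge0 ?sqrtr_ge0 ?invr_ge0 ?powR_ge0// ltW.
rewrite !exprMn !sqr_sqrtr; last 2 first.
- by rewrite addr_ge0 ?sqr_ge0// !mulr_ge0 ?(ltW a0) ?(ltW c0).
- by rewrite addr_ge0 ?sqr_ge0// !mulr_ge0 ?powR_ge0.
rewrite [in leRHS]mulrDr [in leRHS]mulrDl lerD//.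
  have caE : c `^ (1 - al) <= a `^ (1 - al).
    by apply: ge0_ler_powR => //; rewrite ?nnegrE ltW.
  rewrite -!exprMn ler_pXn2r ?nnegrE ?subr_ge0//; last first.
    apply: mulr_ge0; last exact: ltW.
    apply: mulr_ge0; last by rewrite subr_ge0.
    by apply: mulr_ge0; rewrite ?invr_ge0 ltW.
  apply: le_trans (powR_1B_sub_le alP c0 a0) _.
  rewrite [leLHS](_ : _ = (c `^ al)^-1 * ((1 - al) * (a - c))); last by ring.
  rewrite [leRHS](_ : _ = k / m `^ al * ((1 - al) * (a - c))); last by ring.
  rewrite ler_wpM2r ?mulr_ge0 ?(ltW b0) ?subr_ge0//.
  rewrite ler_pdivlMr// mulrC ler_pdivrMr//.
  by rewrite (le_trans cmal)// ler_peMl// ltW.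
have H := @oneBcos_mul_le R (1 - al) th.
have {}H := H ltac:(apply/andP; split; lra) thP.
have {}H : 1 - cos ((1 - al) * th) <= k ^+ 2 * ((1 - al) ^+ 2 * (1 - cos th)).
  apply: le_trans (ler_wpM2l (sqr_ge0 k) H).
  by rewrite mulrA ler_peMl.
have ac0 : 0 <= a * c by rewrite mulr_ge0 ?ltW.
rewrite !powR_1B//.
apply: le_trans (ler_wpM2l _ H) _.
  by rewrite !mulr_ge0 ?invr_ge0// ltW.
rewrite [leLHS](_ : _ = (a `^ al * c `^ al)^-1 *
    (k ^+ 2 * (2 * (a * c) * (1 - cos th)) * (1 - al) ^+ 2)); last first.
  by field; rewrite !gt_eqF.
rewrite [leRHS](_ : _ = (m `^ al ^+ 2)^-1 *
    (k ^+ 2 * (2 * (a * c) * (1 - cos th)) * (1 - al) ^+ 2)); last first.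
  by field; rewrite !gt_eqF.
rewrite ler_wpM2r//.
  by rewrite !mulr_ge0 ?(ltW a0) ?(ltW c0) ?(ltW k0) ?(ltW b0).
by rewrite lef_pV2 ?posrE ?mulr_gt0 ?exprn_gt0// expr2 ler_pM ?(ltW mal).
Qed.

End ConeDistance.

(** * The cone distance between vectors and its infinitesimal form *)

Section QuasihyperbolicDistance.
Context {R : realType} {n : nat}.
Implicit Types (x y u v : 'rV[R]_n).

Definition kdist (al : R) u v : R :=
  cone_dist al (enorm u) (enorm v) (angle u v).

Lemma cone_dist_ge0 (al a c th : R) : 0 < al < 1 -> 0 <= cone_dist al a c th.
Proof.
move=> /andP[_ al1].
by rewrite mulr_ge0 ?sqrtr_ge0 ?invr_ge0 ?subr_ge0 ?ltW.
Qed.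

Lemma enormB_le_kdist (al M : R) u v : 0 < al < 1 -> u != 0 -> v != 0 ->
  enorm u <= M -> enorm v <= M -> enorm (u - v) <= M `^ al * kdist al u v.
Proof.
move=> alP u0 v0 uM vM.
rewrite -(@ler_pXn2r _ 2)// ?nnegrE ?enorm_ge0//; last first.
  by rewrite mulr_ge0 ?powR_ge0 ?cone_dist_ge0.
by rewrite sqr_enormB// sqr_chord_le ?enorm_gt0 ?angle_itv.
Qed.

(** One factor [k] pays for the angle in [cone_dist_le], the other for the lower bound [enorm u / k]
    on both moduli. *)
Lemma kdist_le_enormB (al m k : R) : 0 < al < 1 -> 0 < m -> 1 < k ->
  exists2 d, 0 < d & forall u v, m <= enorm u -> enorm (u - v) < d ->
    v != 0 /\ kdist al u v <= k ^+ 2 / enorm u `^ al * enorm (u - v).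
Proof.
move=> alP m0 k1; have k0 : 0 < k by lra.
have /andP[al0 al1] := alP.
have kV1 : k^-1 < 1 by rewrite invf_lt1.
have kV0 : 0 < k^-1 by rewrite invr_gt0.
have kk : 0 < 1 - k^-1 ^+ 2 by rewrite subr_gt0 expr_lt1// ltW.
have kk1 : k^-1 * (1 - k^-1 ^+ 2) <= 1.
  by rewrite mulr_ile1 ?(ltW kV0) ?(ltW kk) ?(ltW kV1)// gerBl sqr_ge0.
(* The factor [1 - k^-1] forces [enorm v] to be at least [enorm u / k]. The last factor makes
   [2 * (1 - cos (angle u v))] at most [1 - k^-1 ^+ 2], which gives the angle condition of
   [cone_dist_le]. *)
exists (m * (1 - k^-1) * (k^-1 * (1 - k^-1 ^+ 2))).
  by rewrite !mulr_gt0// subr_gt0.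
move=> u v mu uv.
have du1 : enorm (u - v) < enorm u * (1 - k^-1).
  apply: lt_le_trans uv _.
  apply: (@le_trans _ _ (m * (1 - k^-1))).
    by rewrite ler_piMr// mulr_ge0 ?(ltW m0)// subr_ge0 ltW.
  by rewrite ler_wpM2r// subr_ge0 ltW.
have du2 : enorm (u - v) ^+ 2 <= m ^+ 2 * (k^-1 * (1 - k^-1 ^+ 2)).
  have d2 : enorm (u - v) <= m * (k^-1 * (1 - k^-1 ^+ 2)).
    apply: le_trans (ltW uv) _.
    rewrite ler_wpM2r ?mulr_ge0 ?(ltW kk) ?(ltW kV0)//.
    by rewrite ler_piMr ?(ltW m0)// gerBl ltW.
  have d1 : enorm (u - v) <= m.
    by apply: le_trans d2 _; rewrite ler_piMr ?(ltW m0).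
  rewrite expr2 [m ^+ 2]expr2 -[leRHS]mulrA.
  by rewrite ler_pM ?enorm_ge0.
have vu : enorm u / k <= enorm v.
  by have := ler_dist_enorm u v; rewrite ler_norml => /andP[_]; lra.
have nu0 : 0 < enorm u by exact: lt_le_trans mu.
have nv0 : 0 < enorm v by apply: lt_le_trans vu; rewrite mulr_gt0.
have u0 : u != 0 by apply: contraTneq nu0 => ->; rewrite enorm0 ltxx.
have v0 : v != 0 by apply: contraTneq nv0 => ->; rewrite enorm0 ltxx.
split=> //.
have km : 0 < enorm u / k by rewrite mulr_gt0.
have :=
  @cone_dist_le R al (enorm u) (enorm v) (angle u v) (enorm u / k) k alP km.
rewrite -sqr_enormB// sqrtr_sqr (ger0_norm (enorm_ge0 _)) => H.
apply: le_trans (H _ vu (angle_itv _ _) (ltW k1) _) _.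
- by rewrite ler_pdivrMr// ler_peMr ?ltW.
- have cE := sqr_enormB u0 v0.
  have h1 : 2 * (enorm u * enorm v) * (1 - cos (angle u v)) <=
            enorm (u - v) ^+ 2.
    by rewrite cE lerDr sqr_ge0.
  have cge0 : 0 <= 1 - cos (angle u v) by rewrite subr_ge0 cos_le1.
  have h2 : m ^+ 2 * k^-1 * (2 * (1 - cos (angle u v))) <=
            m ^+ 2 * k^-1 * (1 - k^-1 ^+ 2).
    rewrite -[leRHS]mulrA; apply: le_trans du2; apply: le_trans h1.
    rewrite mulrCA [leRHS](_ : _ = 2 * (enorm u * enorm v *
      (1 - cos (angle u v)))); last by ring.
    rewrite ler_pM2l// ler_wpM2r//.
    apply: (@le_trans _ _ (enorm u * (enorm u / k))).
      rewrite expr2 -mulrA ler_pM ?(ltW m0) ?mulr_ge0 ?(ltW kV0) ?(ltW m0)//.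
      by rewrite ler_wpM2r// ltW.
    by rewrite ler_wpM2l ?(ltW nu0).
  rewrite ler_pM2l ?mulr_gt0 ?exprn_gt0// in h2.
  rewrite -ler_pdivrMl ?exprn_gt0// mulr1 -exprVn; lra.
- rewrite ler_wpM2r ?enorm_ge0// powRM ?(ltW nu0) ?(ltW kV0)//.
  rewrite expr2 -mulrA ler_pM2l//.
  rewrite invfM mulrC ler_pM2r ?invr_gt0 ?powR_gt0//.
  rewrite -[leRHS]invrK lef_pV2 ?posrE ?powR_gt0//.
  by apply: ger1_powR; [rewrite kV0 ltW|exact: ltW].
Qed.

End QuasihyperbolicDistance.

(** * Partitions of an interval *)

Section Partition.
Context {R : realType}.
Implicit Types (a b t : R) (p : nat -> R).

Lemma partition_le a b p N i j : is_partition a b p N ->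
  (i <= j <= N)%N -> p i <= p j.
Proof.
move=> [_ [_ pS]] /andP[ij jN]; elim: j ij jN => [|j IH].
  by rewrite leqn0 => /eqP->.
rewrite leq_eqVlt ltnS => /predU1P[->//|ij] jN.
exact: le_trans (IH ij (ltnW jN)) (pS _ jN).
Qed.

Lemma partition_itv a b p N i : is_partition a b p N -> (i <= N)%N ->
  a <= p i <= b.
Proof.
move=> pP iN; have [p0 [pN _]] := pP.
by rewrite -[leLHS]p0 -[X in _ && (_ <= X)]pN !(partition_le pP) ?leqnn ?iN.
Qed.

Lemma partition_rcons a b t p N : is_partition a b p N -> b <= t ->
  is_partition a t (fun i => if (i <= N)%N then p i else t) N.+1.
Proof.
move=> [p0 [pN pS]] bt; split; first by rewrite leq0n.
split=> [|i]; first by rewrite ltnn.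
rewrite ltnS => iN; rewrite iN; case: ltnP => [|Ni]; first exact: pS.
by rewrite (_ : i = N) ?pN//; apply/eqP; rewrite eqn_leq iN.
Qed.

Lemma partition_uniform N :
  is_partition (0 : R) 1 (fun i => i%:R / N.+1%:R) N.+1.
Proof.
split; first by rewrite mul0r.
by split=> [|i _]; rewrite ?divff// ler_wpM2r ?invr_ge0// ler_nat.
Qed.

End Partition.

(** * Arc length and Riemann-Stieltjes line integrals *)

Section ArcLength.
Context {R : realType} {n : nat}.
Implicit Types (g : R -> 'rV[R]_n) (p : nat -> R) (f : 'rV[R]_n -> R).

Lemma chord_sum_rcons g p N b t : p N = b ->
  chord_sum g (fun i => if (i <= N)%N then p i else t) N.+1 =
  chord_sum g p N + enorm (g t - g b).
Proof.
move=> pN; rewrite /chord_sum big_ord_recr/= leqnn ltnn pN; congr (_ + _).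
by apply: eq_bigr => i _; rewrite ltn_ord ltnW.
Qed.

Lemma sum_partition g a b p N (h : R -> R) : is_partition a b p N ->
  \sum_(i < N) (h (p i.+1) - h (p i)) = h b - h a.
Proof.
move=> [<- [<- _]].
by rewrite -(big_mkord xpredT (fun i => h (p i.+1) - h (p i)))
  (telescope_sumr (h \o p)).
Qed.

(** Makes the [sup] in [arclen] genuine: appending the point 1 to a partition of [[0, t]] only adds
    a chord, so the bound over [[0, 1]] applies. *)
Lemma has_sup_chord_sum g t : rectifiable g -> 0 <= t <= 1 ->
  has_sup [set l | exists p N, is_partition 0 t p N /\ l = chord_sum g p N].
Proof.
move=> [M gM] /andP[t0 t1]; split.
  eexists; exists (fun i => if (i <= 0)%N then 0 else t), 1%N; split=> //.
  by apply: (@partition_rcons _ _ 0 _ (fun=> 0) 0%N).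
exists M => _ [p [N [pP ->]]].
have pN := pP.2.1; have := gM _ _ (partition_rcons pP t1).
rewrite (chord_sum_rcons _ _ pN) => /(le_trans _); apply.
by rewrite lerDl enorm_ge0.
Qed.

(** Appending [t] to a partition of [[0, s]] adds exactly this chord to its sum. *)
Lemma enormB_le_arclen g (s t : R) :
  rectifiable g -> 0 <= s -> s <= t -> t <= 1 ->
  enorm (g t - g s) <= arclen g t - arclen g s.
Proof.
move=> gr s0 st t1; rewrite lerBrDr -lerBrDl.
have sP : 0 <= s <= 1 by rewrite s0 (le_trans st).
have tP : 0 <= t <= 1 by rewrite t1 (le_trans s0).
apply: ge_sup; first by have [] := has_sup_chord_sum gr sP.
move=> _ [p [N [pP ->]]]; rewrite lerBrDl addrC.
rewrite -(chord_sum_rcons _ _ pP.2.1); apply: ub_le_sup.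
  by have [] := has_sup_chord_sum gr tP.
by do 2 eexists; split; [exact: partition_rcons pP st|].
Qed.

Lemma chord_sum_lipschitz g (K a b : R) p N :
  (forall s t : R, a <= s -> s <= t -> t <= b ->
    enorm (g t - g s) <= K * (t - s)) ->
  is_partition a b p N -> chord_sum g p N <= K * (b - a).
Proof.
move=> gK pP; rewrite mulrBr -(sum_partition g (fun t => K * t) pP).
apply: ler_sum => i _; rewrite -mulrBr.
have /andP[+ _] := partition_itv pP (ltnW (ltn_ord i)).
have /andP[_ +] := partition_itv pP (ltn_ord i).
by move=> pb ap; apply: gK => //; have [_ [_ ->]] := pP.
Qed.

Lemma rectifiable_lipschitz g (K : R) :
  (forall s t : R, 0 <= s -> s <= t -> t <= 1 ->
    enorm (g t - g s) <= K * (t - s)) ->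
  rectifiable g.
Proof.
by move=> gK; exists (K * (1 - 0)) => p N; exact: chord_sum_lipschitz.
Qed.

(* A partition of [0, t] is cut at [s] by clamping its points from above and
   from below, which avoids inserting [s] among them. *)
Lemma arclen_lipschitz g (K s t : R) :
  rectifiable g -> 0 <= s -> s <= t -> t <= 1 ->
  (forall s' t' : R, s <= s' -> s' <= t' -> t' <= t ->
     enorm (g t' - g s') <= K * (t' - s')) ->
  arclen g t - arclen g s <= K * (t - s).
Proof.
move=> gr s0 st t1 gK; rewrite lerBlDl.
have sP : 0 <= s <= 1 by rewrite s0 (le_trans st).
have tP : 0 <= t <= 1 by rewrite t1 (le_trans s0).
apply: ge_sup; first by have [] := has_sup_chord_sum gr tP.
move=> _ [p [N [pP ->]]]; have [p0 [pN pS]] := pP.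
have P1 : is_partition 0 s (fun i => Num.min (p i) s) N.
  split; first by rewrite p0 min_l.
  split=> [|i iN]; first by rewrite pN min_r.
  by rewrite le_min ge_min (pS _ iN)/= ge_min lexx orbT.
have P2 : is_partition s t (fun i => Num.max (p i) s) N.
  split; first by rewrite p0 max_r.
  split=> [|i iN]; first by rewrite pN max_l.
  by rewrite ge_max le_max (pS _ iN)/= le_max lexx orbT.
apply: (@le_trans _ _ (chord_sum g (fun i => Num.min (p i) s) N +
                       chord_sum g (fun i => Num.max (p i) s) N)).
  rewrite -big_split; apply: ler_sum => i _ /=.
  have pSi := pS _ (ltn_ord i).
  (* An interval on one side of [s] has one degenerate clamped chord; only one with [s] inside needs
     the triangle inequality. *)
  have [h1|h1] := leP (p i.+1) s; have [h2|h2] := leP (p i) s.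
  - by rewrite subrr enorm0 addr0.
  - by have := lt_le_trans h2 (le_trans pSi h1); rewrite ltxx.
  - rewrite (_ : g (p i.+1) - g (p i) = g s - g (p i) + (g (p i.+1) - g s)).
      exact: ler_enormD.
    by rewrite [RHS]addrC addrA subrK.
  - by rewrite subrr enorm0 add0r.
apply: lerD; last exact: chord_sum_lipschitz P2.
apply: ub_le_sup; last by do 2 eexists; split; first exact: P1.
by have [] := has_sup_chord_sum gr sP.
Qed.

(** The increments of [F] telescope over a fine partition. Each is at most [k] times a term of the
    Riemann-Stieltjes sum tagged at left endpoints, since chords are shorter than arcs. *)
Lemma line_integral_ge f g F (I : R) :
  rectifiable g -> line_integral_is f g I ->
  (forall k, 1 < k -> exists2 d : R, 0 < d & forall s t : R,
     0 <= s -> s <= t -> t <= 1 -> t - s < d ->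
     F (g t) - F (g s) <= k * (f (g s) * enorm (g t - g s))) ->
  (forall t : R, 0 <= t <= 1 -> 0 <= f (g t)) ->
  F (g 1) - F (g 0) <= I.
Proof.
move=> gr gI HF f0; apply/ler_addgt0Pr => e' e'0.
(* Chosen so that [(1 + e) * (I + e)] is at most [I + e']. *)
pose e := Num.min 1 (e' / (`|I| + 2)).
have I2 : 0 < `|I| + 2 by rewrite ltr_wpDl.
have e0 : 0 < e by rewrite lt_min ltr01 divr_gt0.
have e1 : e <= 1 by rewrite ge_min lexx.
have ee' : e * (`|I| + 2) <= e'.
  by rewrite -ler_pdivlMr// ge_min lexx orbT.
have [d d0 Hd] := HF (1 + e) ltac:(lra).
have [d' d'0 Hd'] := gI _ e0.
pose N := Num.trunc (Num.min d d')^-1.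
have Nd : N.+1%:R^-1 < Num.min d d'.
  rewrite invf_plt ?posrE ?lt_min ?d0//.
  by apply: truncnS_gt; rewrite invr_ge0 le_min !ltW.
pose p i : R := i%:R / N.+1%:R.
have pP : is_partition 0 1 p N.+1 by exact: partition_uniform.
have pd i : p i.+1 - p i < Num.min d d'.
  by rewrite /p -mulrBl -natrB// subSnn mul1r.
have /(_ p N.+1 p pP) := Hd'.
have pS := pP.2.2.
case/(_ _ _)/Wrap => [i iN|i iN|].
- by apply: lt_le_trans (pd i) _; rewrite ge_min lexx orbT.
- by rewrite lexx pS.
rewrite ltr_norml => /andP[_ HI].
rewrite -(sum_partition g (F \o g) pP).
apply: (@le_trans _ _ ((1 + e) * \sum_(i < N.+1)
    f (g (p i)) * (arclen g (p i.+1) - arclen g (p i)))).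
  rewrite mulr_sumr; apply: ler_sum => i _ /=.
  have /andP[pi0 pi1] := partition_itv pP (ltnW (ltn_ord i)).
  have /andP[pSi0 pSi1] := partition_itv pP (ltn_ord i).
  have pii := pS _ (ltn_ord i).
  apply: le_trans (Hd _ _ pi0 pii pSi1 _) _.
    by apply: lt_le_trans (pd i) _; rewrite ge_min lexx.
  rewrite ler_wpM2l ?addr_ge0 ?(ltW e0)//.
  rewrite ler_wpM2l ?f0 ?pi0//.
  exact: enormB_le_arclen.
have H2 : I <= `|I| by exact: ler_norm.
rewrite ltrBlDr in HI.
have e10 : 0 <= 1 + e by lra.
apply: le_trans (ler_wpM2l e10 (ltW HI)) _.
have : e * e <= e by rewrite ler_piMr// ltW.
have : e * I <= e * `|I| by rewrite ler_wpM2l// ltW.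
lra.
Qed.

(** The parameter increments add up to 1, so summing the bounds traps every fine sum between
    [k^-1 * I] and [k * I]. *)
Lemma line_integral_sandwich f g (I : R) : 0 <= I ->
  (forall k, 1 < k -> exists2 d : R, 0 < d & forall s r t : R,
     0 <= s -> s <= r <= t -> t <= 1 -> t - s < d ->
     k^-1 * (I * (t - s)) <= f (g r) * (arclen g t - arclen g s)
       <= k * (I * (t - s))) ->
  line_integral_is f g I.
Proof.
move=> I0 H e e0; have I1 : 0 < I + 1 by lra.
(* Both [k * I - I] and [I - k^-1 * I] are then below [e]; adding 1 to [I] avoids a zero divisor. *)
pose k := 1 + e / (I + 1).
have ee : 0 < e / (I + 1) by rewrite divr_gt0.
have k1 : 1 < k by rewrite ltrDl.
have [d d0 Hd] := H k k1; exists d => // p N xi pP pd xiP.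
have S1 : \sum_(i < N) (p i.+1 - p i) = 1.
  by rewrite (sum_partition g id pP)/= subr0.
set S := \sum_(i < N) _.
have Hi (i : 'I_N) := Hd (p i) (xi i) (p i.+1)
  (proj1 (andP (partition_itv pP (ltnW (ltn_ord i))))) (xiP _ (ltn_ord i))
  (proj2 (andP (partition_itv pP (ltn_ord i)))) (pd _ (ltn_ord i)).
have lo : k^-1 * I <= S.
  rewrite -[I]mulr1 -S1 !mulr_sumr; apply: ler_sum => i _.
  by have /andP[] := Hi i.
have up : S <= k * I.
  rewrite -[I]mulr1 -S1 !mulr_sumr; apply: ler_sum => i _.
  by have /andP[] := Hi i.
have eI : e / (I + 1) * I < e.
  by rewrite mulrAC ltr_pdivrMr// ltr_pM2l//; lra.
have kI : I - k^-1 * I <= e / (I + 1) * I.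
  rewrite -[X in X - _]mul1r -mulrBl ler_wpM2r//.
  rewrite (_ : 1 - k^-1 = k^-1 * (e / (I + 1))); last first.
    by rewrite (_ : e / (I + 1) = k - 1) ?mulrBr ?mulVf ?mulr1 ?gt_eqF//;
      rewrite /k; lra.
  by rewrite ler_piMl ?(ltW ee)// invf_le1 ?ltW//; lra.
rewrite ltr_norml; apply/andP; split; first lra.
by rewrite /k mulrDl mul1r in up; lra.
Qed.

End ArcLength.

(** * Continuity of paths in the Euclidean norm *)

Section PathContinuity.
Context {R : realType} {n : nat}.
Implicit Types (g : R -> 'rV[R]_n) (e s t : R).

Lemma is_path_near g e t : is_path g -> 0 <= t <= 1 -> 0 < e ->
  exists2 d : R, 0 < d & forall s, 0 <= s <= 1 -> `|t - s| < d ->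
    enorm (g t - g s) < e.
Proof.
move=> /subspace_continuousP gc tP e0.
have t01 : `[0, 1]%classic t by rewrite /= in_itv.
have n1 : 0 < n.+1%:R :> R by rewrite ltr0n.
have := gc _ t01 => /cvgrPdist_lt /(_ (e / n.+1%:R)).
rewrite divr_gt0// => /(_ isT) /nbhs_ballP[d d0 dP].
exists d => // s sP ts; have := dP s ts.
rewrite /= in_itv/= sP => /(_ isT) gts.
apply: le_lt_trans (enorm_le_mx_norm _) _.
rewrite mulrC; move: gts; rewrite ltr_pdivlMr//; apply: le_lt_trans.
by rewrite ler_wpM2l// ler_nat.
Qed.

(** Uniform continuity by compactness of [[0, 1]], as a near-covering property with the radius
    tending to 0 from the right. *)
Lemma is_path_uniform g e : is_path g -> 0 < e ->
  exists2 d : R, 0 < d & forall s t, 0 <= s <= 1 -> 0 <= t <= 1 ->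
    `|s - t| < d -> enorm (g s - g t) < e.
Proof.
move=> gp e0; have e20 : 0 < e / 2 by rewrite divr_gt0.
have /compact_near_coveringP/near_covering_withinP cov :=
  @segment_compact R 0 1.
pose P (d s : R) := forall t : R, 0 <= t <= 1 ->
  `|s - t| < d -> enorm (g s - g t) < e.
have [] := cov R (0^'+) P _ _.
  move=> s; rewrite /= in_itv/= => sP.
  have [d d0 dP] := is_path_near gp sP e20.
  (* With both radii below [d / 2], the points [s'] and [t] lie within [d] of [s]. *)
  exists (ball s (d / 2), [set r | r < d / 2]) => /=.
    split; first by apply: nbhsx_ballx; rewrite divr_gt0.
    by apply: nbhs_right_lt; rewrite divr_gt0.
  move=> [s' r]/= [ss' rd]; rewrite in_itv/= => s'P t tP s't.
  have h1 : enorm (g s - g t) < e / 2.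
    apply: dP => //; rewrite -(subrKA s') (le_lt_trans (ler_normD _ _))//.
    by have : `|s - s'| < d / 2 := ss'; lra.
  have h2 : enorm (g s - g s') < e / 2.
    by apply: dP => //; have : `|s - s'| < d / 2 := ss'; lra.
  rewrite -(subrKA (g s)) (le_lt_trans (ler_enormD _ _))// enormB; lra.
move=> d /= d0 dP; exists (d / 2); first by rewrite divr_gt0.
have d20 : 0 < d / 2 by rewrite divr_gt0.
move=> s t sP; apply: dP => //=.
by rewrite sub0r normrN gtr0_norm//; lra.
Qed.

(** A path keeps a positive distance from the origin, where the density blows up. *)
Lemma is_path_enorm_min g : is_path g -> (forall t, 0 <= t <= 1 -> g t != 0) ->
  exists2 m : R, 0 < m & forall t, 0 <= t <= 1 -> m <= enorm (g t).
Proof.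
move=> gp g0.
have [|t tP min_t] := @EVT_min R (fun t => enorm (g t)) 0 1 ler01.
  apply/subspace_continuousP => t; rewrite /= in_itv/= => tP.
  apply/cvgrPdist_lt => e e0; have [d d0 dP] := is_path_near gp tP e0.
  apply/nbhs_ballP; exists d => // s ts; rewrite /= in_itv/= => sP.
  exact: le_lt_trans (ler_dist_enorm _ _) (dP _ sP ts).
rewrite in_itv/= in tP; exists (enorm (g t)); first by rewrite enorm_gt0 ?g0.
by move=> s sP; apply: min_t; rewrite in_itv.
Qed.

Lemma is_path_lipschitz g (K : R) :
  (forall s t, 0 <= s -> s <= t -> t <= 1 ->
    enorm (g t - g s) <= K * (t - s)) ->
  is_path g.
Proof.
move=> gK; have K0 : 0 <= K.
  have := gK 0 1 (lexx _) ler01 (lexx _); rewrite subr0 mulr1.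
  exact: le_trans (enorm_ge0 _).
have {}gK s t : 0 <= s <= 1 -> 0 <= t <= 1 -> enorm (g s - g t) <= K * `|s - t|.
  move=> /andP[s0 s1] /andP[t0 t1]; have [st|/ltW ts] := leP s t.
    by rewrite enormB distrC ger0_norm ?subr_ge0// gK.
  by rewrite ger0_norm ?subr_ge0// gK.
apply/subspace_continuousP => t; rewrite /= in_itv/= => tP.
apply/cvgrPdist_lt => e e0; apply/nbhs_ballP; exists (e / (K + 1)).
  by rewrite /= divr_gt0// ltr_wpDl.
move=> s ts; rewrite /= in_itv/= => sP.
have {}ts : `|t - s| < e / (K + 1) := ts.
rewrite ltr_pdivlMr ?ltr_wpDl// in ts.
apply: (@le_lt_trans _ _ (enorm (g t - g s))).
  rewrite [`|_ - _|]mx_normrE; apply/bigmax_leP; split=> [|[i j] _ /=].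
    exact: enorm_ge0.
  by rewrite ord1; exact: ler_coord_enorm.
apply: le_lt_trans (gK _ _ tP sP) _; apply: le_lt_trans ts.
by rewrite mulrC ler_wpM2l// lerDl.
Qed.

End PathContinuity.

(** * Lower bound by a 1-Lipschitz potential *)

Section LowerBound.
Context {R : realType} {n : nat}.
Implicit Types (x y z u v : 'rV[R]_n).

(* The linear function in direction [(c, s)] on the cone, in polar
   coordinates around [x]. *)
Definition potential (al c s : R) x z : R :=
  (1 - al)^-1 * (enorm z `^ (1 - al) *
    (c * cos ((1 - al) * angle x z) + s * sin ((1 - al) * angle x z))).

(** Law of cosines in the plane, which identifies the radicand of [cone_dist] as a squared chord. *)
Lemma polar_sqr (A B p q : R) :
  (B * cos q - A * cos p) ^+ 2 + (B * sin q - A * sin p) ^+ 2 =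
  (A - B) ^+ 2 + 2 * (A * B) * (1 - cos (p - q)).
Proof.
have cp : cos p ^+ 2 = 1 - sin p ^+ 2 by rewrite cos2sin2.
have cq : cos q ^+ 2 = 1 - sin q ^+ 2 by rewrite cos2sin2.
rewrite cosB; transitivity (B ^+ 2 * (cos q ^+ 2 + sin q ^+ 2) +
  A ^+ 2 * (cos p ^+ 2 + sin p ^+ 2) -
  2 * (A * B) * (cos p * cos q + sin p * sin q)); first by ring.
by rewrite cp cq; ring.
Qed.

Lemma potential_le (al c s : R) x u v : 0 < al < 1 -> c ^+ 2 + s ^+ 2 = 1 ->
  x != 0 -> u != 0 -> v != 0 ->
  potential al c s x v - potential al c s x u <= kdist al u v.
Proof.
move=> /andP[al0 al1] cs x0 u0 v0; rewrite /potential /kdist /cone_dist -mulrBr.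
have b0 : 0 <= 1 - al by lra.
rewrite ler_wpM2l ?invr_ge0//; set B := enorm v `^ _; set A := enorm u `^ _.
set p := (1 - al) * angle x u; set q := (1 - al) * angle x v.
set X := B * cos q - A * cos p; set Y := B * sin q - A * sin p.
rewrite [leLHS](_ : _ = c * X + s * Y); last by rewrite /X /Y; ring.
apply: le_trans (ler_norm _) _; rewrite -sqrtr_sqr ler_wsqrtr//.
(* Cauchy-Schwarz against the unit vector [(c, s)]; the triangle inequality for angles then bounds
   the planar chord by the cone distance. *)
apply: (@le_trans _ _ (X ^+ 2 + Y ^+ 2)).
  have : 0 <= (c * Y - s * X) ^+ 2 by exact: sqr_ge0.
  have : (c * X + s * Y) ^+ 2 + (c * Y - s * X) ^+ 2 =
    (c ^+ 2 + s ^+ 2) * (X ^+ 2 + Y ^+ 2) by ring.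
  by rewrite cs mul1r; lra.
rewrite polar_sqr lerD2l ler_wpM2l ?mulr_ge0 ?powR_ge0//.
rewrite lerD2l lerN2 -mulrBr; apply: cos_mul_angle_triangle => //.
by rewrite b0/=; lra.
Qed.

Lemma potential_attained (al : R) x y : 0 < al < 1 -> x != 0 -> y != 0 ->
  exists c s : R, c ^+ 2 + s ^+ 2 = 1 /\
    potential al c s x y - potential al c s x x = kdist al x y.
Proof.
move=> alP x0 y0; rewrite /potential /kdist /cone_dist.
set A := enorm x `^ _; set B := enorm y `^ _.
set p := (1 - al) * angle x x; set q := (1 - al) * angle x y.
have p0 : p = 0 by rewrite /p angle_id// mulr0.
set S := _ + 2 * _ * _.
have SE : (B * cos q - A * cos p) ^+ 2 + (B * sin q - A * sin p) ^+ 2 = S.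
  by rewrite polar_sqr p0 sub0r cosN.
set X := B * cos q - A * cos p in SE; set Y := B * sin q - A * sin p in SE.
(* If the two images coincide, any direction works; otherwise the normalized chord [(X, Y)] is
   taken. *)
have [S0|S0] := eqVneq S 0.
  exists 1, 0; rewrite expr1n expr0n addr0; split=> //.
  rewrite S0 sqrtr0 mulr0 -mulrBr.
  suff -> : B * (1 * cos q + 0 * sin q) - A * (1 * cos p + 0 * sin p) = 0.
    by rewrite mulr0.
  rewrite !mul1r !mul0r !addr0; apply/eqP; rewrite -/X.
  have /eqP := SE; rewrite S0 paddr_eq0 ?sqr_ge0// => /andP[].
  by rewrite sqrf_eq0.
have Sge0 : 0 <= S by rewrite -SE addr_ge0// sqr_ge0.
have rS : Num.sqrt S ^+ 2 = S by exact: sqr_sqrtr.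
have rS0 : Num.sqrt S != 0 by rewrite gt_eqF// sqrtr_gt0 lt0r S0.
exists (X / Num.sqrt S), (Y / Num.sqrt S); split.
  by rewrite !expr_div_n -mulrDl SE rS divff.
rewrite -mulrBr; congr (_ * _).
rewrite [LHS](_ : _ = (X ^+ 2 + Y ^+ 2) / Num.sqrt S); last first.
  by rewrite /X /Y; ring.
by rewrite SE -[X in X / _]rS expr2 mulfK.
Qed.

(** The potential that attains [kdist al x y] is followed along the path: its small increments are
    at most [kdist], hence at most nearly the density times the chord. *)
Lemma line_integral_ge_kdist (al I : R) x y (g : R -> 'rV[R]_n) :
  0 < al < 1 -> x != 0 -> y != 0 ->
  is_path g -> rectifiable g -> g 0 = x -> g 1 = y ->
  (forall t, 0 <= t <= 1 -> g t != 0) ->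
  line_integral_is (fun z => (enorm z `^ al)^-1) g I -> kdist al x y <= I.
Proof.
move=> alP x0 y0 gp gr g0 g1 gn0 gI.
have [c [s [cs <-]]] := potential_attained alP x0 y0.
have <- : potential al c s x (g 1) - potential al c s x (g 0) =
  potential al c s x y - potential al c s x x by rewrite g0 g1.
apply: (line_integral_ge (F := potential al c s x) gr gI); last first.
  by move=> t _; rewrite invr_ge0 powR_ge0.
move=> k k1; have [m m0 mP] := is_path_enorm_min gp gn0.
(* The square root is used since [kdist_le_enormB] loses the square of its constant. *)
have sk1 : 1 < Num.sqrt k by rewrite -[ltLHS]sqrtr1 ltr_sqrt//; lra.
have [e e0 eP] := @kdist_le_enormB R n al m _ alP m0 sk1.
have [d d0 dP] := is_path_uniform gp e0.
exists d => // r t r0 rt t1 trd.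
have rP : 0 <= r <= 1 by rewrite r0 (le_trans rt).
have tP : 0 <= t <= 1 by rewrite t1 (le_trans r0).
apply: le_trans (potential_le _ _ _ _ _) _ => //; try exact: gn0.
have [|_] := eP (g r) (g t) (mP _ rP).
  by apply: dP => //; rewrite distrC ger0_norm ?subr_ge0.
by rewrite sqr_sqrtr ?(enormB (g t)) ?mulrA//; lra.
Qed.

End LowerBound.

(** * An orthonormal frame of a plane through two vectors *)

Section Frame.
Context {R : realType} {n : nat}.
Implicit Types (x y e v : 'rV[R]_n).

Lemma edot_delta i e : edot (delta_mx 0 i) e = e 0 i.
Proof.
rewrite /edot (bigD1 i)//= big1 => [|j ji]; rewrite mxE ?eqxx ?mul1r ?addr0//.
by rewrite (negPf ji) andbF mul0r.
Qed.

Lemma exists_orthogonal e : (2 <= n)%N -> exists2 v, v != 0 & edot v e = 0.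
Proof.
move=> n2; pose i := Ordinal (ltnW n2); pose j := Ordinal n2.
have ij : (i == j) = false by [].
have d0 k : delta_mx 0 k != 0 :> 'rV[R]_n.
  apply/eqP => /rowP/(_ k); rewrite !mxE !eqxx => /eqP.
  by rewrite oner_eq0.
have [ei|ei] := eqVneq (e 0 i) 0.
  by exists (delta_mx 0 i); rewrite ?edot_delta.
exists (e 0 j *: delta_mx 0 i - e 0 i *: delta_mx 0 j).
  apply/eqP => /rowP/(_ j); rewrite !mxE !eqxx eq_sym ij/= mulr0 sub0r mulr1.
  by move/eqP; rewrite oppr_eq0 (negPf ei).
by rewrite !edotE !edot_delta mulrC subrr.
Qed.

Lemma edot_normalize v : v != 0 ->
  edot ((enorm v)^-1 *: v) ((enorm v)^-1 *: v) = 1.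
Proof.
move=> v0; rewrite !edotE mulrA -sqr_enorm -invfM -expr2 mulVf//.
by rewrite expf_neq0// gt_eqF// enorm_gt0.
Qed.

(** Gram-Schmidt, with the component [w] of [y] orthogonal to [x], of norm
    [enorm y * sin (angle x y)]. *)
Lemma orthonormal_frame x y : (2 <= n)%N -> x != 0 -> y != 0 ->
  exists e1 e2, [/\ edot e1 e1 = 1, edot e2 e2 = 1, edot e1 e2 = 0,
    x = enorm x *: e1 &
    y = enorm y *: (cos (angle x y) *: e1 + sin (angle x y) *: e2)].
Proof.
move=> n2 x0 y0; pose e1 := (enorm x)^-1 *: x.
have nx0 : enorm x != 0 by rewrite gt_eqF// enorm_gt0.
have xE : x = enorm x *: e1 by rewrite scalerA divff// scale1r.
have e11 : edot e1 e1 = 1 by exact: edot_normalize.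
have ye1 : edot y e1 = enorm y * cos (angle x y).
  by rewrite edotZr edotC edot_angle// -mulrA mulKf.
clearbody e1.
pose w := y - edot y e1 *: e1.
have we1 : edot e1 w = 0.
  by rewrite edotC !edotE e11 mulr1 subrr.
have nw : enorm w = enorm y * sin (angle x y).
  apply: enorm_sqrP.
    by rewrite mulr_ge0 ?enorm_ge0// sin_ge0_pi// angle_itv.
  rewrite exprMn sin2cos2 /w !edotE e11 (edotC e1 y) ye1 -sqr_enorm.
  by ring.
have yE : y = (enorm y * cos (angle x y)) *: e1 + w.
  by rewrite /w ye1 addrC subrK.
(* For parallel vectors the sine vanishes, so any unit vector orthogonal to [e1] completes the
   frame; dimension at least 2 provides one. *)
have [w0|w0] := eqVneq w 0.
  have [v v0 ve1] := exists_orthogonal e1 n2.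
  have nv0 : enorm v != 0 by rewrite gt_eqF// enorm_gt0.
  exists e1, ((enorm v)^-1 *: v); split=> //.
  - exact: edot_normalize.
  - by rewrite edotZr edotC ve1 mulr0.
  have /eqP : enorm y * sin (angle x y) = 0 by rewrite -nw w0 enorm0.
  rewrite mulf_eq0 gt_eqF ?enorm_gt0//= => /eqP->.
  by rewrite scale0r addr0 scalerA {1}yE w0 addr0.
have nw0 : enorm w != 0 by rewrite gt_eqF// enorm_gt0.
exists e1, ((enorm w)^-1 *: w); split=> //.
- exact: edot_normalize.
- by rewrite edotZr we1 mulr0.
by rewrite scalerDr !scalerA -nw divff// scale1r.
Qed.

End Frame.

(** * The geodesic and the value of the infimum *)

Section Geodesic.
Context {R : realType} {n : nat}.
Implicit Types (x y e : 'rV[R]_n).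

Definition polar e1 e2 (r phi : R) : 'rV[R]_n :=
  r *: (cos phi *: e1 + sin phi *: e2).

Lemma edot_polar e1 e2 (r r' p p' : R) :
  edot e1 e1 = 1 -> edot e2 e2 = 1 -> edot e1 e2 = 0 ->
  edot (polar e1 e2 r p) (polar e1 e2 r' p') = r * r' * cos (p - p').
Proof.
move=> e11 e22 e12; rewrite /polar !edotE (edotC e2 e1) e11 e22 e12 cosB.
by ring.
Qed.

Lemma enorm_polar e1 e2 (r p : R) :
  edot e1 e1 = 1 -> edot e2 e2 = 1 -> edot e1 e2 = 0 -> 0 <= r ->
  enorm (polar e1 e2 r p) = r.
Proof.
move=> e11 e22 e12 r0; apply: enorm_sqrP => //.
by rewrite edot_polar// subrr cos0 mulr1 expr2.
Qed.

(** The angle is an [acos], which lies in [[0, pi]]; hence the restriction to the upper half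
    plane. *)
Lemma polar_coordinates (U V : R) : 0 <= V -> 0 < U ^+ 2 + V ^+ 2 ->
  let N := Num.sqrt (U ^+ 2 + V ^+ 2) in
  let psi := acos (U / N) in
  [/\ 0 < N, 0 <= psi <= pi, U = N * cos psi & V = N * sin psi].
Proof.
move=> V0 UV N psi; have N0 : 0 < N by rewrite sqrtr_gt0.
have N2 : N ^+ 2 = U ^+ 2 + V ^+ 2 by rewrite sqr_sqrtr// ltW.
have UN : -1 <= U / N <= 1.
  rewrite -ler_norml normrM normfV (gtr0_norm N0) ler_pdivrMr// mul1r.
  by rewrite -sqrtr_sqr ler_wsqrtr// lerDl sqr_ge0.
split=> //; first by rewrite acos_ge0 ?acos_lepi.
  by rewrite acosK ?in_itv//= mulrC divfK// gt_eqF.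
rewrite sin_acos// -[X in Num.sqrt X](_ : (V / N) ^+ 2 = _).
  by rewrite sqrtr_sqr ger0_norm ?divr_ge0 ?(ltW N0)// mulrC divfK// gt_eqF.
apply/eqP; rewrite !expr_div_n N2 eq_sym subr_eq -mulrDl addrC divff//.
by rewrite gt_eqF.
Qed.

(* The geodesic is the preimage of a segment under the map
   [r e^(i phi) |-> r^b e^(i b phi)]; here [(U, V)] runs along that segment and
   [N], [psi] are its polar coordinates. *)
Lemma exists_geodesic (al : R) x y : 0 < al < 1 ->
  (2 <= n)%N -> x != 0 -> y != 0 ->
  exists (g : R -> 'rV[R]_n) (M : R), [/\ g 0 = x, g 1 = y,
    forall t, 0 <= t <= 1 -> g t != 0 /\ enorm (g t) <= M &
    forall s t, 0 <= s -> s <= t -> t <= 1 ->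
      kdist al (g s) (g t) = kdist al x y * (t - s)].
Proof.
move=> /andP[al0 al1] n2 x0 y0.
have [e1 [e2 [e11 e22 e12 xE yE]]] := orthonormal_frame n2 x0 y0.
set th := angle x y in yE *.
have /andP[th0 thpi] : 0 <= th <= pi by exact: angle_itv.
pose b := 1 - al; have b0 : 0 < b by rewrite /b; lra.
have bN0 : b != 0 by rewrite gt_eqF.
have [bth0 bthpi] : 0 <= b * th /\ b * th < pi.
  split; first by rewrite mulr_ge0 ?(ltW b0).
  have [->|thN0] := eqVneq th 0; first by rewrite mulr0 pi_gt0.
  by apply: lt_le_trans thpi; rewrite gtr_pMl ?lt0r ?thN0// /b; lra.
pose A := enorm x `^ b; pose B := enorm y `^ b.
have [A0 B0] : 0 < A /\ 0 < B by rewrite !powR_gt0 ?enorm_gt0.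
pose C := cos (b * th); pose S := sin (b * th).
have S0 : 0 <= S by rewrite sin_ge0_pi// bth0 ltW.
have CS : C ^+ 2 + S ^+ 2 = 1 by exact: cos2Dsin2.
have C1 : C <= 1 by exact: cos_le1.
pose U t := (1 - t) * A + t * B * C; pose V t := t * B * S.
pose N t := Num.sqrt (U t ^+ 2 + V t ^+ 2); pose psi t := acos (U t / N t).
(* Since [b * th < pi], a vanishing sine means [b * th = 0]. This keeps the segment away from the
   apex. *)
have CS0 : S = 0 -> C = 1.
  move=> S00; have [bt|bt] := eqVneq (b * th) 0; first by rewrite /C bt cos0.
  have : 0 < S by rewrite sin_gt0_pi// lt0r bt bth0.
  by rewrite S00 ltxx.
have V0 t : 0 <= t -> 0 <= V t by move=> t0; rewrite !mulr_ge0// ltW.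
have UV t : 0 <= t <= 1 -> 0 < U t ^+ 2 + V t ^+ 2.
  move=> /andP[t0 t1]; rewrite lt0r addr_ge0 ?sqr_ge0// andbT.
  rewrite paddr_eq0 ?sqr_ge0// !sqrf_eq0 andbC; apply/negP => /andP[].
  rewrite /U /V !mulf_eq0 (gt_eqF B0) orbF => /orP[/eqP->|/eqP/CS0->].
    by rewrite !mul0r addr0 subr0 mul1r gt_eqF.
  rewrite mulr1 paddr_eq0 ?mulr_ge0 ?subr_ge0 ?(ltW A0) ?(ltW B0)//.
  rewrite !mulf_eq0 (gt_eqF A0) (gt_eqF B0) !orbF => /andP[/eqP h /eqP h'].
  by move: h; rewrite h' subr0 => /eqP; rewrite oner_eq0.
have pc t : 0 <= t <= 1 ->
    [/\ 0 < N t, 0 <= psi t <= pi, U t = N t * cos (psi t) &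
        V t = N t * sin (psi t)].
  by move=> tP; apply: polar_coordinates; [apply: V0; case/andP: tP|exact: UV].
have psile t : 0 <= t <= 1 -> psi t <= b * th.
  move=> tP; have [N0 /andP[p0 ppi] UE VE] := pc t tP.
  have /andP[t0 t1] := tP.
  (* The product equals [(1 - t) * A * S], so the segment stays in the sector of opening
     [b * th]. *)
  have : 0 <= N t * sin (b * th - psi t).
    rewrite sinB mulrBr mulrCA -UE mulrCA -VE -/C -/S.
    rewrite (_ : _ - _ = (1 - t) * A * S); last by rewrite /U /V; ring.
    by rewrite !mulr_ge0 ?subr_ge0// ltW.
  rewrite pmulr_rge0// => h; rewrite leNgt; apply/negP => bp.
  move: h; apply/negP.
  rewrite -ltNge -opprB sinN oppr_lt0.
  (* For opening 0 the sine is inconclusive at [psi t = pi], which would make [U t] negative. *)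
  have [bt|bt] := eqVneq (b * th) 0; last first.
    rewrite sin_gt0_pi// subr_gt0 bp/= ltrBlDr (le_lt_trans ppi)//.
    by rewrite ltrDl lt0r bt.
  rewrite bt subr0; rewrite bt in bp; rewrite sin_gt0_pi// bp/=.
  rewrite lt_neqAle ppi andbT; apply/eqP => pE.
  have : U t = - N t by rewrite UE pE cospi mulrN1.
  have : 0 <= U t.
    rewrite /U /C bt cos0 mulr1.
    by rewrite addr_ge0 ?mulr_ge0 ?subr_ge0 ?(ltW A0) ?(ltW B0).
  by move=> + E; rewrite E oppr_ge0 leNgt N0.
pose g t := polar e1 e2 (N t `^ b^-1) (psi t / b).
have ng t : enorm (g t) = N t `^ b^-1 by rewrite enorm_polar// powR_ge0.
have ngb t : enorm (g t) `^ b = N t.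
  by rewrite ng -powRrM mulVf// powRr1// sqrtr_ge0.
have gn0 t : 0 <= t <= 1 -> g t != 0.
  move=> tP; have [N0 _ _ _] := pc t tP.
  have : 0 < enorm (g t) by rewrite ng powR_gt0.
  by apply: contraTneq => ->; rewrite enorm0 ltxx.
exists g, ((A + B) `^ b^-1); split.
- have N0 : N 0 = A.
    by rewrite /N /U /V !mul0r expr0n !addr0 subr0 mul1r sqrtr_sqr gtr0_norm.
  rewrite /g /psi N0 [U 0](_ : _ = A) ?divff ?gt_eqF//; last first.
    by rewrite /U !mul0r addr0 subr0 mul1r.
  rewrite acos1 mul0r /polar cos0 sin0 scale1r scale0r addr0 /A -powRrM divff//.
  by rewrite powRr1 ?enorm_ge0.
- have N1 : N 1 = B.
    rewrite /N /U /V subrr mul0r add0r mul1r.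
    by rewrite !exprMn -mulrDr CS mulr1 sqrtr_sqr gtr0_norm.
  rewrite /g /psi N1 [U 1](_ : _ = B * C); last first.
    by rewrite /U subrr mul0r add0r mul1r.
  rewrite mulrAC divff ?gt_eqF// mul1r cosK ?in_itv/= ?bth0 ?ltW//.
  rewrite mulrAC divff// mul1r /polar /B -powRrM divff//.
  by rewrite powRr1 ?enorm_ge0.
- move=> t tP; split; first exact: gn0.
  have /andP[t0 t1] := tP.
  rewrite ng; apply: ge0_ler_powR; rewrite ?nnegrE ?invr_ge0 ?(ltW b0)//.
  + exact: sqrtr_ge0.
  + by rewrite addr_ge0// ltW.
  rewrite -[leRHS]ger0_norm ?addr_ge0 ?(ltW A0) ?(ltW B0)// -sqrtr_sqr.
  rewrite ler_wsqrtr//; apply: (@le_trans _ _ (((1 - t) * A + t * B) ^+ 2)).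
    rewrite -subr_ge0 (_ : _ - _ = 2 * ((1 - t) * t * (A * B)) * (1 - C) +
      (t * B) ^+ 2 * (1 - (C ^+ 2 + S ^+ 2))); last by rewrite /U /V; ring.
    by rewrite CS subrr mulr0 addr0 !mulr_ge0 ?subr_ge0// ltW.
  have h1 : (1 - t) * A <= A by rewrite ler_piMl ?(ltW A0)// gerBl.
  have h2 : t * B <= B by rewrite ler_piMl ?(ltW B0).
  rewrite ler_pXn2r ?nnegrE ?lerD//.
    by rewrite addr_ge0 ?mulr_ge0 ?subr_ge0 ?(ltW A0) ?(ltW B0).
  by rewrite addr_ge0// ltW.
- move=> s t s0 st t1.
  have sP : 0 <= s <= 1 by rewrite s0 (le_trans st).
  have tP : 0 <= t <= 1 by rewrite t1 (le_trans s0).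
  have [Ns0 /andP[ps0 _] UsE VsE] := pc s sP.
  have [Nt0 /andP[pt0 _] UtE VtE] := pc t tP.
  (* Both [psi s] and [psi t] lie in [[0, b * th]], so the quotient is at most [th <= pi] and is a
     genuine angle. *)
  have angE : angle (g s) (g t) = `|psi s - psi t| / b.
    apply: angleP; [exact: gn0|exact: gn0| |].
      rewrite divr_ge0 ?(ltW b0)//= ler_pdivrMr// mulrC.
      apply: (@le_trans _ _ (b * th)); last by rewrite ler_wpM2l// ltW.
      have := psile s sP; have := psile t tP.
      by rewrite ler_norml => *; apply/andP; split; lra.
    rewrite edot_polar// -!ng -mulrBl -[in RHS]cos_norm.
    by rewrite -[in LHS]cos_norm !normrM normr_id.
  rewrite /kdist /cone_dist angE -/th -/b !ngb -/A -/B -/C -[RHS]mulrA.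
  congr (_ * _).
  (* The cone distance is now the planar distance of two points of the segment, hence [t - s] times
     its length. *)
  rewrite [b * (_ / b)]mulrC divfK// cos_norm -polar_sqr -UtE -UsE -VtE -VsE.
  rewrite -[t - s in RHS]ger0_norm ?subr_ge0// -[X in _ * X]sqrtr_sqr -sqrtrM.
    congr Num.sqrt; rewrite (_ : _ + _ = ((A - B) ^+ 2 + 2 * (A * B) * (1 - C) +
      B ^+ 2 * ((C ^+ 2 + S ^+ 2) - 1)) * (t - s) ^+ 2); last first.
      by rewrite /U /V; ring.
    by rewrite CS subrr mulr0 addr0.
  by rewrite addr_ge0 ?sqr_ge0// !mulr_ge0 ?subr_ge0 ?(ltW A0) ?(ltW B0).
Qed.

(** Proportionality of [kdist] to the parameter traps short arc lengths between multiples of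
    [D * (t - s)], to which [line_integral_sandwich] applies. *)
Lemma geodesic_line_integral (al M D : R) (g : R -> 'rV[R]_n) :
  0 < al < 1 -> 0 <= D ->
  (forall t, 0 <= t <= 1 -> g t != 0 /\ enorm (g t) <= M) ->
  (forall s t, 0 <= s -> s <= t -> t <= 1 ->
    kdist al (g s) (g t) = D * (t - s)) ->
  [/\ is_path g, rectifiable g &
      line_integral_is (fun z => (enorm z `^ al)^-1) g D].
Proof.
move=> alP D0 gM gD; have /andP[al0 al1] := alP.
have gn0 t : 0 <= t <= 1 -> g t != 0 by move=> /gM[].
(* Used with the global bound [M] for continuity and rectifiability, and with a local bound for the
   sharp estimate of arc length. *)
have lip (K s0 t0 : R) : 0 <= s0 -> t0 <= 1 ->
    (forall t, s0 <= t <= t0 -> enorm (g t) <= K) ->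
    forall s t, s0 <= s -> s <= t -> t <= t0 ->
      enorm (g t - g s) <= K `^ al * D * (t - s).
  move=> s00 t01 gK s t s0s st tt0; rewrite -mulrA -gD//; last 2 first.
  - exact: le_trans s0s.
  - exact: le_trans t01.
  rewrite enormB; apply: enormB_le_kdist => //.
  - by apply: gn0; apply/andP; split; lra.
  - by apply: gn0; apply/andP; split; lra.
  - by apply: gK; apply/andP; split; lra.
  - by apply: gK; apply/andP; split; lra.
have lip1 := lip M 0 1 (lexx _) (lexx _) (fun t tP => proj2 (gM t tP)).
have gp := is_path_lipschitz lip1; have gr := rectifiable_lipschitz lip1.
split=> //; apply: line_integral_sandwich => // k k1.
have [m m0 mP] := is_path_enorm_min gp gn0.
(* The lower bound costs [q ^+ 3]: a square from [kdist_le_enormB] and one factor for moving the tag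
   from [s] to [r]. The upper bound costs [q]. *)
pose q := Num.sqrt (Num.sqrt k).
have q1 : 1 < q.
  have h (r : R) : 1 < r -> 1 < Num.sqrt r.
    by move=> r1; rewrite -[ltLHS]sqrtr1 ltr_sqrt//; lra.
  exact/h/h.
have q0 : 0 < q by lra.
have q4 : q ^+ 4 = k.
  by rewrite (exprM q 2 2) !sqr_sqrtr ?sqrtr_ge0//; lra.
have q3k : q ^+ 3 <= k by rewrite -q4 ler_eXn2l.
have qk : q <= k by apply: le_trans q3k; rewrite -[leLHS]expr1 ler_eXn2l.
have [e e0 eP] := @kdist_le_enormB R n al m q alP m0 q1.
(* The second term makes moduli at nearby parameters agree up to the factor [q]. *)
pose e' := Num.min e ((q - 1) * m).
have e'0 : 0 < e' by rewrite lt_min e0 mulr_gt0// subr_gt0.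
have [d d0 dP] := is_path_uniform gp e'0.
have ratio r t : 0 <= r <= 1 -> 0 <= t <= 1 -> `|t - r| < d ->
    enorm (g t) <= q * enorm (g r).
  move=> rP tP /(dP _ _ tP rP); rewrite lt_min => /andP[_ h].
  have := ler_dist_enorm (g t) (g r); rewrite ler_norml => /andP[_ h'].
  have : (q - 1) * m <= (q - 1) * enorm (g r).
    by rewrite ler_wpM2l ?mP// subr_ge0 ltW.
  lra.
have powq (u : 'rV[R]_n) : (q * enorm u) `^ al <= q * enorm u `^ al.
  rewrite powRM ?enorm_ge0 ?(ltW q0)// ler_wpM2r ?powR_ge0//.
  by apply: ler1_powR; lra.
exists d => // s r t s0 /andP[sr rt] t1 std.
have sP : 0 <= s <= 1 by apply/andP; split; lra.
have rP : 0 <= r <= 1 by apply/andP; split; lra.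
have tP : 0 <= t <= 1 by apply/andP; split; lra.
have st : s <= t by lra.
have gs0 : 0 < enorm (g s) `^ al by rewrite powR_gt0// enorm_gt0// gn0.
have gr0 : 0 < enorm (g r) `^ al by rewrite powR_gt0// enorm_gt0// gn0.
have L0 : 0 <= arclen g t - arclen g s.
  exact: le_trans (enorm_ge0 _) (enormB_le_arclen gr s0 st t1).
have ts0 : 0 <= D * (t - s) by rewrite mulr_ge0// subr_ge0.
apply/andP; split.
  have [|_] := eP (g s) (g t) (mP _ sP).
    have : `|s - t| < d by rewrite distrC ger0_norm// subr_ge0.
    by move=> /(dP _ _ sP tP); rewrite lt_min => /andP[].
  rewrite gD// => h.
  have rs : enorm (g r) `^ al <= q * enorm (g s) `^ al.
    apply: le_trans (powq _); apply: ge0_ler_powR; rewrite ?(ltW al0) ?nnegrE//.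
    - exact: enorm_ge0.
    - by rewrite mulr_ge0 ?enorm_ge0// ltW.
    - by apply: ratio => //; rewrite ger0_norm ?subr_ge0//; lra.
  have hL : enorm (g s - g t) <= arclen g t - arclen g s.
    by rewrite enormB; exact: enormB_le_arclen.
  rewrite ler_pdivrMl; last by lra.
  apply: (@le_trans _ _ (q ^+ 3 * ((enorm (g r) `^ al)^-1 *
      (arclen g t - arclen g s)))); last first.
    by rewrite ler_wpM2r// mulr_ge0 ?invr_ge0 ?powR_ge0.
  apply: le_trans h _; rewrite mulrA ler_pM ?enorm_ge0//.
    by rewrite divr_ge0 ?powR_ge0 ?sqr_ge0.
  rewrite ler_pdivrMr// mulrAC ler_pdivlMr// (exprSr q 2) -[leRHS]mulrA.
  by rewrite ler_wpM2l ?sqr_ge0.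
(* Upper bound: all moduli on [[s, t]] are at most [q * enorm (g r)], which gives a local Lipschitz
   constant. *)
have := @arclen_lipschitz R n g ((q * enorm (g r)) `^ al * D) s t gr s0 st t1.
have gK t' : s <= t' <= t -> enorm (g t') <= q * enorm (g r).
  move=> /andP[st' t't]; apply: ratio => //; first by apply/andP; split; lra.
  by rewrite ltr_norml; apply/andP; split; lra.
move=> /(_ (lip _ s t s0 t1 gK)) h.
rewrite mulrC ler_pdivrMr//; apply: le_trans h _.
rewrite -mulrA [leRHS]mulrAC; rewrite ler_wpM2r//.
by apply: le_trans (powq _) _; rewrite ler_wpM2r// powR_ge0.
Qed.

(** The geodesic attains the lower bound valid for all paths, so the infimum is a minimum. *)
Lemma k_alphaE (al : R) x y : 0 < al < 1 -> (2 <= n)%N -> x != 0 -> y != 0 ->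
  k_alpha al x y = kdist al x y.
Proof.
move=> alP n2 x0 y0.
have [g [M [g0 g1 gM gD]]] := exists_geodesic alP n2 x0 y0.
have [gp gr gI] := geodesic_line_integral alP (cone_dist_ge0 _ _ _ alP) gM gD.
rewrite /k_alpha; set E := [set I | _].
have Ek : E (kdist al x y).
  by exists g; do ![split=> //] => t /gM[].
have lbE : lbound E (kdist al x y).
  move=> I [h [hp [hr [h0 [h1 [hn0 hI]]]]]].
  exact: line_integral_ge_kdist hn0 hI.
apply/eqP; rewrite eq_le; apply/andP; split.
  by apply: ge_inf => //; exists (kdist al x y).
by apply: lb_le_inf => //; exists (kdist al x y).
Qed.

End Geodesic.

(** * The limit of the cone distance as the exponent tends to 1 *)

Section Limit.
Context {R : realType}.
Implicit Types (a c th b h : R).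

Lemma is_derive0_cvg (f : R -> R) (df : R) :
  is_derive (0 : R) 1 f df -> f 0 = 0 ->
  h^-1 * f h @[h --> 0^'] --> df.
Proof.
move=> fd f0; have := @ex_derive _ _ _ _ _ _ _ fd.
rewrite /derivable => H.
have := @derive_val _ _ _ _ _ _ _ fd; rewrite /derive => <-.
have -> : (fun h => h^-1 * f h) =
  (fun h => h^-1 *: ((f \o shift 0) (h *: (1 : R)) - f 0)).
  by apply/funext => h /=; rewrite f0 subr0 addr0 /GRing.scale/= mulr1.
exact: H.
Qed.

Lemma powR_expR a h : 0 < a -> a `^ h = expR (h * ln a).
Proof. by move=> a0; rewrite /powR gt_eqF. Qed.

(** With [h = 1 - al], the factor [h^-1] moved under the root yields difference quotients at 0 of
    [f] and [s], with limits [ln a - ln c] and [th]; the weight [expR (h * (ln a + ln c))] tends to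
    1. *)
Lemma cvg_cone_dist a c th : 0 < a -> 0 < c ->
  (cone_dist al a c th) @[al --> (1 : R)^'-] -->
  Num.sqrt (th ^+ 2 + ln (a / c) ^+ 2).
Proof.
move=> a0 c0; have lim0 : (1 - al) @[al --> (1 : R)^'-] --> (0 : R)^'.
  move=> P [e /= e0 eP]; exists e => //= al; rewrite /ball_/= => al1 alt1.
  apply: eP; last by rewrite subr_eq0 gt_eqF.
  by rewrite /ball_/= sub0r normrN.
pose f h := expR (h * ln a) - expR (h * ln c).
have fc : h^-1 * f h @[h --> 0^'] --> ln a - ln c.
  apply: is_derive0_cvg; last by rewrite /f !mul0r subrr.
  by apply: is_derive_eq; rewrite /GRing.scale/= !mul0r !expR0; ring.
pose s h := 2 * sin (h * (th / 2)).
have sc : h^-1 * s h @[h --> 0^'] --> th.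
  apply: is_derive0_cvg; last by rewrite /s mul0r sin0 mulr0.
  by apply: is_derive_eq; rewrite /GRing.scale/= !mul0r !cos0; field.
have ec : expR (h * (ln a + ln c)) @[h --> (0 : R)^'] --> (1 : R).
  have -> : (1 : R) = expR (0 * (ln a + ln c)) by rewrite mul0r expR0.
  apply: continuous_cvg; first exact: continuous_expR.
  by apply: cvgMl; exact: cvg_within.
pose G h := Num.sqrt ((h^-1 * f h) ^+ 2 +
                      expR (h * (ln a + ln c)) * (h^-1 * s h) ^+ 2).
have Gc : G h @[h --> 0^'] --> Num.sqrt (th ^+ 2 + ln (a / c) ^+ 2).
  apply: continuous_cvg; first exact: sqrt_continuous.
  rewrite [th ^+ 2 + _]addrC ln_div ?posrE// -[th ^+ 2]mul1r.
  by apply: cvgD; [exact: cvgM|apply: cvgM => //; exact: cvgM].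
apply: (@cvg_trans _ ((G \o (fun al => 1 - al)) al @[al --> (1 : R)^'-]));
  last first.
  exact: cvg_comp lim0 Gc.
apply: near_eq_cvg; near=> al.
have b0 : 0 < 1 - al by rewrite subr_gt0; near: al; exact: nbhs_left_lt.
rewrite /= /G /cone_dist !powR_expR//; set b := 1 - al.
rewrite -[b^-1 in RHS]ger0_norm ?invr_ge0 ?ltW// -sqrtr_sqr -sqrtrM ?sqr_ge0//.
congr Num.sqrt; rewrite oneBcos /f /s (mulrDr b (ln a)) expRD.
rewrite (_ : b * th / 2 = b * (th / 2)); last by rewrite mulrA.
by ring.
Unshelve. all: by end_near. Qed.

End Limit.

Theorem theorem1p4 (R : realType) (n : nat) (x y : 'rV[R]_n) :
  (2 <= n)%N -> x != 0 -> y != 0 ->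
  (forall alpha : R, 0 < alpha < 1 ->
     let beta := 1 - alpha in
     k_alpha alpha x y =
       beta^-1 * Num.sqrt (enorm x `^ (2 * beta) + enorm y `^ (2 * beta)
                - 2 * enorm x `^ beta * enorm y `^ beta
                    * cos (beta * angle x y)))
  /\
  ((fun alpha => k_alpha alpha x y) @ (1 : R)^'- -->
     Num.sqrt (angle x y ^+ 2 + ln (enorm x / enorm y) ^+ 2)).
Proof.
move=> n2 x0 y0; split=> [alpha alP beta|].
  rewrite k_alphaE// /kdist /cone_dist -/beta; congr (_ * Num.sqrt _).
  have sqrE (a : R) : a `^ (2 * beta) = (a `^ beta) ^+ 2.
    by rewrite mulrC powRrM powR_mulrn ?powR_ge0.
  by rewrite !sqrE; ring.
(* Left of 1 and close to it, [alpha] lies between 0 and 1, where [k_alpha] has the closed form. *)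
apply: (@cvg_trans _ (kdist alpha x y @[alpha --> (1 : R)^'-])); last first.
  by apply: cvg_cone_dist; apply: enorm_gt0.
apply: near_eq_cvg; near=> alpha; rewrite k_alphaE//.
apply/andP; split; near: alpha; [exact: nbhs_left_gt|exact: nbhs_left_lt].
Unshelve. all: by end_near. Qed.
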